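(* Let $q\ge 2$ and $1\le r<q$ be coprime integers, and let $\omega=e^{2\pi i/q}$. For $z>0$ the following hold. (1) If $q$ is odd, then $$P_{r,q}(z)=\rho(z)\,B_z(1)\prod_{k=1}^{(q-1)/2}|B_z(\omega^k)|^2\ \ge 0 .$$ Hence every positive real zero of $\mathcal{D}_{r,q}$ has even multiplicity, and $\mathcal{D}_{r,q}$ does not change sign there. (2) If $q$ is even, then $$P_{r,q}(z)=\rho(z)\,B_z(1)\,B_z(-1)\prod_{k=1}^{q/2-1}|B_z(\omega^k)|^2,$$ where $$B_z(-1)=\sum_{i=0}^{q-1}(-1)^i\frac{V_i(z)}{F(z)^{i/q}} .$$ Consequently, every $z_0>0$ at which $\mathcal{D}_{r,q}$ has a sign-changing zero satisfies $B_{z_0}(-1)=0$; and every zero $z_0>0$ of $\mathcal{D}_{r,q}$ contributed only by the nonreal Fourier modes (i.e. with $B_{z_0}(-1)\neq0$) has even multiplicity.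
   Context: For coprime integers $q\ge2$, $1\le r<q$, let $c_i = ir \bmod q\in\{0,\dots,q-1\}$ for every integer $i$ (so $c_i$ is $q$-periodic in $i$). Empty products equal $1$. Define $$\mathcal{D}_{r,q}(z)=\det\left[\prod_{m=0}^{j-1}(z+c_{i+m})\right]_{0\le i,j\le q-1},$$ $$V_0(z)=1,\qquad V_i(z)=\prod_{m=0}^{i-1}(z+c_m)\quad(1\le i\le q),\qquad F(z)=V_q(z)=\prod_{a=0}^{q-1}(z+a).$$ For $z>0$ let $F(z)^{1/q}>0$ be the positive $q$-th root, and put $$B_z(\xi)=\sum_{i=0}^{q-1}\frac{V_i(z)}{F(z)^{i/q}}\,\xi^i\quad(\xi\in\mathbb{C}),\qquad P_{r,q}(z)=(-1)^{(q-1)(q-2)/2}\,\mathcal{D}_{r,q}(z),\qquad \rho(z)=\frac{F(z)^{q-1}}{\prod_{i=0}^{q-1}V_i(z)}>0 .$$ A sign-changing zero is a real zero across which the real polynomial $\mathcal{D}_{r,q}$ changes sign. *)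

(* Defs.v *)
From mathcomp Require Import all_boot all_order all_algebra.
From mathcomp Require Import complex.
From mathcomp Require Import reals exp trigo.
Set Implicit Arguments.
Unset Strict Implicit.
Unset Printing Implicit Defensive.
Import Order.TTheory GRing.Theory Num.Theory.
Local Open Scope ring_scope.
Local Open Scope complex_scope.

(* Only nonnegative indices occur below, so the q-periodic sequence
   i |-> i r mod q is indexed by nat. *)
Definition c (r q i : nat) : nat := (i * r %% q)%N.

Definition Dpoly (R : realType) (r q : nat) : {poly R} :=
  \det (\matrix_(i < q, j < q) \prod_(m < j) ('X + (c r q (i + m))%:R%:P)).

Definition Ppoly (R : realType) (r q : nat) : {poly R} :=
  (-1) ^+ ((q.-1 * q.-2)./2) * Dpoly R r q.

Definition V (R : realType) (r q i : nat) (z : R) : R :=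
  \prod_(m < i) (z + (c r q m)%:R).

Definition F (R : realType) (q : nat) (z : R) : R := \prod_(a < q) (z + a%:R).

Lemma V_full (R : realType) (r q : nat) (z : R) :
  (0 < q)%N -> coprime q r -> V r q q z = F q z.
Proof.
move=> q_gt0 cop; rewrite /V /F.
pose h (m : 'I_q) : 'I_q := Ordinal (ltn_pmod (m * r) q_gt0).
have h_inj : injective h.
  suff le_inj (x y : 'I_q) : (x <= y)%N -> h x = h y -> x = y.
    by move=> x y e; case/orP: (leq_total x y) => l;
      [apply: le_inj|apply/esym/le_inj].
  move=> xy /(congr1 val)/= /eqP; rewrite eq_sym eqn_mod_dvd ?leq_mul2r ?xy ?orbT//.
  rewrite -mulnBl Gauss_dvdl// => dv.
  have lt_q : (y - x < q)%N by rewrite (leq_ltn_trans (leq_subr _ _)).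
  apply/val_inj/anti_leq; rewrite /= xy /= -subn_eq0 -(modn_small lt_q).
  exact: dv.
by rewrite [RHS](reindex_inj h_inj).
Qed.

Definition rootF (R : realType) (q : nat) (z : R) : R := F q z `^ q%:R^-1.

Definition B (R : realType) (r q : nat) (z : R) (xi : R[i]) : R[i] :=
  \sum_(i < q) (V r q i z / rootF q z ^+ i)%:C * xi ^+ i.

Definition rho (R : realType) (r q : nat) (z : R) : R :=
  F q z ^+ q.-1 / \prod_(i < q) V r q i z.

Definition omega (R : realType) (q : nat) : R[i] :=
  cos (2 * pi / q%:R) +i* sin (2 * pi / q%:R).

(* [mup x 0] is 0 by convention, whereas the multiplicity of a zero only makes
   sense for a nonzero polynomial. *)
Definition even_multiplicity (R : realType) (p : {poly R}) (x : R) : Prop :=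
  p != 0 /\ ~~ odd (mup x p).

Definition sign_changing_zero (R : realType) (p : {poly R}) (x : R) : Prop :=
  root p x /\
  exists2 e : R, 0 < e &
    forall u v : R, x - e < u < x -> x < v < x + e -> p.[u] * p.[v] < 0.

(* Main.v *)
(* For z > 0 the matrix of D(z) is, up to left and right multiplication by
   positive diagonal matrices, the Hankel matrix (w_(i+j)) with
   w_n = V_n(z) / F(z)^(n/q), and w is q-periodic because V_(n+q) = F V_n.
   The discrete Fourier transform turns such a matrix into a diagonal one with
   entries B_z(omega^k), composed with the permutation i |-> -i mod q, whose
   sign (-1)^((q-1)(q-2)/2) is the one in P. Since conj(B_z(omega^k)) =
   B_z(omega^(q-k)), the modes k and q - k pair up into |B_z(omega^k)|^2, so
   the sign of P(z) is that of the unpaired real factor B_z(-1) (q even) or is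
   nonnegative (q odd). A zero of odd multiplicity is sign changing, and
   D is not the zero polynomial since D(0) <> 0. *)
Require Import Defs.
From mathcomp Require Import all_boot all_order all_algebra all_fingroup.
From mathcomp Require Import complex.
From mathcomp Require Import reals exp trigo.
From mathcomp Require Import topology normedtype derive realfun.
From mathcomp Require Import ring lra zify.
Set Implicit Arguments.
Unset Strict Implicit.
Unset Printing Implicit Defensive.
Import Order.TTheory GRing.Theory Num.Theory numFieldNormedType.Exports.
Local Open Scope ring_scope.
Local Open Scope complex_scope.

(** * Sign of negation modulo n + 1 *)

Definition rev_perm (n : nat) : 'S_n := perm (@rev_ord_inj n).

Lemma rev_permS (n : nat) :
  rev_perm n.+1 = lift_perm ord0 ord_max (rev_perm n).
Proof.
apply/permP => i; case: (unliftP ord0 i) => [j|] ->.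
  rewrite lift_perm_lift !permE; apply/val_inj => /=.
  by have := ltn_ord j; rewrite /bump leq0n /= => lt_jn; case: (leqP n) => ? /=; lia.
by rewrite lift_perm_id permE; apply/val_inj => /=; lia.
Qed.

(** Removing the pair 0 |-> n from the reversal of n + 1 points contributes parity n, which is
    Pascal's rule for 'C(n + 1, 2). *)
Lemma odd_rev_perm (n : nat) : odd_perm (rev_perm n) = odd 'C(n, 2).
Proof.
elim: n => [|n IHn].
  by rewrite (_ : rev_perm 0 = 1%g) ?odd_perm1//; apply/permP => -[].
by rewrite rev_permS odd_lift_perm IHn /= binS bin1 oddD addbC.
Qed.

(** The map i |-> -i mod n + 1: fixing 0 and reversing the other n points gives it the sign of
    [rev_perm n]. *)
Definition neg_perm (n : nat) : 'S_n.+1 := lift_perm ord0 ord0 (rev_perm n).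

Lemma neg_perm0 (n : nat) : neg_perm n ord0 = ord0.
Proof. exact: lift_perm_id. Qed.

Lemma neg_perm_gt0 (n : nat) (i : 'I_n.+1) :
  (0 < i)%N -> neg_perm n i = (n.+1 - i)%N :> nat.
Proof.
case: (unliftP ord0 i) => [j|] ->//= _.
by rewrite lift_perm_lift permE /= /bump !leq0n !add1n subSS subnSK ?ltn_ord.
Qed.

Lemma odd_neg_perm (n : nat) : odd_perm (neg_perm n) = odd 'C(n, 2).
Proof. by rewrite odd_lift_perm /= odd_rev_perm. Qed.

(** * Determinants of periodic Hankel matrices *)

Lemma sum_periodic_shift (M : zmodType) (n : nat) (h : nat -> M) (i : nat) :
  (forall j, h (j + n)%N = h j) -> \sum_(j < n) h (i + j)%N = \sum_(j < n) h j.
Proof.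
move=> hP; elim: i => [//|i <-].
apply/(addrI (h i)).
transitivity (\sum_(j < n.+1) h (i + j)%N).
  by rewrite big_ord_recl addn0; under eq_bigr do rewrite addSnnS.
by rewrite big_ord_recr /= hP addrC.
Qed.

(** This is a Vandermonde matrix in the distinct powers of [w]. *)
Lemma det_fourier_neq0 (K : fieldType) (n : nat) (w : K) :
  n.-primitive_root w -> \det (\matrix_(i < n, j < n) w ^+ (i * j)) != 0.
Proof.
move=> prim_w.
rewrite (_ : \matrix_(i, j) _ = Vandermonde n (\row_j w ^+ j)).
  rewrite det_Vandermonde; apply/prodf_neq0 => i _; apply/prodf_neq0 => j lt_ij.
  rewrite !mxE subr_eq0 (eq_prim_root_expr prim_w) !modn_small//.
  by rewrite gtn_eqF.
by apply/matrixP => i j; rewrite !mxE -exprM mulnC.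
Qed.

(** Taking determinants in [HU] below, the nonzero factor [\det U] cancels and the sign of negation
    remains. *)
Lemma det_hankel_periodic (K : fieldType) (n : nat) (w : K) (a : nat -> K) :
  n.+1.-primitive_root w -> (forall j, a (j + n.+1)%N = a j) ->
  \det (\matrix_(i < n.+1, j < n.+1) a (i + j)%N) =
  (-1) ^+ 'C(n, 2) * \prod_(k < n.+1) \sum_(j < n.+1) a j * (w ^+ k) ^+ j.
Proof.
move=> prim_w aP; set H := (X in \det X).
have w1 := prim_expr_order prim_w.
have wn0 : w != 0.
  by apply/negP => /eqP w0; move/eqP: w1; rewrite w0 expr0n/= eq_sym oner_eq0.
pose U := \matrix_(i < n.+1, j < n.+1) w ^+ (i * j).
pose lam := \row_(k < n.+1) \sum_(j < n.+1) a j * (w ^+ k) ^+ j.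
(* the Fourier modes are mapped by H to their conjugates *)
have HU : H *m U = row_perm (neg_perm n) U *m diag_mx lam.
  apply/matrixP => i k; rewrite mul_mx_diag !mxE.
  (* After multiplication by w^(ik) the right side is [lam] at k, as i + neg_perm(i) is 0 or n + 1,
     and the left side is the same sum with its index shifted by i. *)
  apply: (mulfI (expf_neq0 (i * k) wn0)); rewrite mulrA -exprD.
  have -> : w ^+ (i * k + neg_perm n i * k) = 1.
    rewrite -mulnDl; case: (posnP i) => [i0|i_gt0].
      by rewrite (_ : i = ord0) ?neg_perm0//; apply: val_inj.
    by rewrite (neg_perm_gt0 i_gt0) (subnKC (ltnW (ltn_ord i))) exprM w1 expr1n.
  rewrite mul1r -(@sum_periodic_shift _ _ (fun j => a j * (w ^+ k) ^+ j) i).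
    rewrite mulr_sumr; apply: eq_bigr => j _; rewrite !mxE.
    by rewrite mulrCA -exprM -exprD; congr (_ * w ^+ _); ring.
  by move=> j; rewrite aP exprD (exprAC _ _ n.+1) w1 expr1n mulr1.
apply: (mulIf (det_fourier_neq0 prim_w)).
rewrite -det_mulmx HU det_mulmx row_permE det_mulmx det_perm odd_neg_perm.
rewrite signr_odd det_diag mulrAC; congr (_ * _ * _).
by apply: eq_bigr => k _; rewrite mxE.
Qed.

(** * The primitive root of unity and its conjugates *)

Lemma omegaX (R : realType) (q n : nat) :
  omega R q ^+ n =
  cos (2 * pi / q%:R * n%:R) +i* sin (2 * pi / q%:R * n%:R).
Proof.
elim: n => [|n IHn]; first by rewrite mulr0 cos0 sin0.
set t := _ / _ in IHn *; rewrite exprSr IHn -[n.+1]addn1 natrD mulrDr mulr1 cosD sinD.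
by apply/eqP; rewrite eq_complex /=; apply/andP; split; apply/eqP; ring.
Qed.

Lemma primitive_omega (R : realType) (q : nat) :
  (0 < q)%N -> q.-primitive_root (omega R q).
Proof.
move=> q_gt0; have q0 : q%:R != 0 :> R by rewrite pnatr_eq0 -lt0n.
have qp : 0 < q%:R :> R by rewrite ltr0n.
apply/andP; split=> //; apply/forallP => i; apply/eqP.
rewrite unity_rootE omegaX.
(* With the angle written as 2t, a power equal to 1 forces sin t = 0 because cos 2t = 1 - 2 sin^2 t;
   but 0 < t < pi when i + 1 < q. *)
have -> : 2 * pi / q%:R * i.+1%:R = (pi * (i.+1%:R / q%:R)) *+ 2 :> R.
  by rewrite mulr2n; ring.
have [->|neq_iq] := eqVneq i.+1 q.
  by rewrite divff// mulr1 cos2pi sin2pi eqxx.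
have lt_iq : (i.+1 < q)%N by rewrite ltn_neqAle neq_iq ltn_ord.
apply/negbTE/negP => /eqP[+ _].
have /sin_gt0_pi : 0 < (pi : R) * (i.+1%:R / q%:R) < pi.
  by rewrite mulr_gt0 ?pi_gt0 ?divr_gt0 ?ltr0n//= gtr_pMr ?pi_gt0//
    ltr_pdivrMr// mul1r ltr_nat.
set t := (_ * _) => sin_gt0; rewrite cos_mulr2n cos2sin2 => h.
have /eqP : sin t ^+ 2 = 0 by lra.
by rewrite expf_eq0 /= gt_eqF.
Qed.

Lemma omegaX_half (R : realType) (m : nat) :
  (0 < m)%N -> omega R m.*2 ^+ m = -1.
Proof.
move=> m_gt0; rewrite omegaX -mul2n natrM.
have m_neq0 : m%:R != 0 :> R by rewrite pnatr_eq0 -lt0n.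
have -> : 2 * pi / (2 * m%:R) * m%:R = pi :> R by field.
by rewrite cospi sinpi; apply/eqP; rewrite eq_complex /= oppr0 !eqxx.
Qed.

(** Both sides are inverse to omega^k: one by cos^2 + sin^2 = 1, the other by omega^q = 1. *)
Lemma conjc_omegaX (R : realType) (q k : nat) :
  (0 < q)%N -> (k <= q)%N -> ((omega R q ^+ k)^*)%C = omega R q ^+ (q - k).
Proof.
move=> q_gt0 le_kq; have w1 := prim_expr_order (primitive_omega R q_gt0).
have w_unit : omega R q ^+ k \is a GRing.unit.
  by rewrite unitrX// unitfE; apply/negP => /eqP w0; move/eqP: w1;
    rewrite w0 expr0n eqn0Ngt q_gt0 /= eq_sym oner_eq0.
apply: (mulrI w_unit); rewrite -exprD subnKC// w1 omegaX.
by apply/eqP; rewrite eq_complex /=; apply/andP; split; apply/eqP;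
  [rewrite mulrN opprK -!expr2 cos2Dsin2|ring].
Qed.

(** * Pairing the indices k and q - k in a product *)

Lemma prod_reflect (M : comPzSemiRingType) (g : nat -> M) (m q : nat) : (m <= q)%N ->
  \prod_(q.+1 - m <= k < q) g k = \prod_(1 <= k < m) g (q - k)%N.
Proof.
elim: m => [|m IHm] le_mq; first by rewrite !big_geq// subn0.
rewrite subSS; case: m => [|m] in IHm le_mq *; first by rewrite subn0 !big_geq.
rewrite big_ltn; last by lia.
rewrite big_nat_recr//= -IHm; last by lia.
rewrite subSS subnSK; last by lia.
by rewrite [RHS]mulrC.
Qed.

(** Modulo 2m + 1, the involution k |-> -k fixes only 0. *)
Lemma prod_pair_odd (M : comPzSemiRingType) (g h : nat -> M) (m : nat) :
  (forall k, (0 < k <= m)%N -> g k * g (m.*2.+1 - k)%N = h k) ->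
  \prod_(k < m.*2.+1) g k = g 0 * \prod_(1 <= k < m.+1) h k.
Proof.
move=> gh; rewrite -(big_mkord xpredT g) big_ltn//; congr (_ * _).
rewrite (big_cat_nat (n := m.+1))//=; last by lia.
rewrite {2}(_ : m.+1 = m.*2.+2 - m.+1)%N; last by lia.
rewrite prod_reflect; last by lia.
by rewrite -big_split; apply: eq_big_nat => k hk; apply: gh.
Qed.

(** Modulo 2m, both 0 and m are fixed, so two factors stay unpaired. *)
Lemma prod_pair_even (M : comPzSemiRingType) (g h : nat -> M) (m : nat) : (0 < m)%N ->
  (forall k, (0 < k < m)%N -> g k * g (m.*2 - k)%N = h k) ->
  \prod_(k < m.*2) g k = g 0 * g m * \prod_(1 <= k < m) h k.
Proof.
move=> m_gt0 gh; rewrite -(big_mkord xpredT g) big_ltn; last by lia.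
rewrite (big_cat_nat (n := m))//=; last by lia.
rewrite [X in _ * (_ * X)]big_ltn; last by lia.
rewrite (_ : m.+1 = m.*2.+1 - m)%N; last by lia.
rewrite prod_reflect; last by lia.
rewrite -mulrA [X in _ * X = _]mulrCA; congr (_ * (_ * _)).
by rewrite -big_split; apply: eq_big_nat => k hk; apply: gh.
Qed.

(** * The products V and their periodic normalization *)

Lemma cDq (r q i : nat) : c r q (i + q) = c r q i.
Proof. by rewrite /c mulnDl addnC [(q * r)%N]mulnC modnMDl. Qed.

Lemma VD (R : realType) (r q i j : nat) (z : R) :
  V r q (i + j) z = V r q i z * \prod_(m < j) (z + (c r q (i + m))%:R).
Proof. by rewrite /V big_split_ord. Qed.

Lemma VDq (R : realType) (r q j : nat) (z : R) :
  (0 < q)%N -> coprime q r -> V r q (j + q) z = F q z * V r q j z.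
Proof.
move=> q_gt0 cop; rewrite addnC VD (V_full _ q_gt0 cop); congr (_ * _).
by apply: eq_bigr => m _; rewrite addnC cDq.
Qed.

Lemma V_gt0 (R : realType) (r q i : nat) (z : R) : 0 < z -> 0 < V r q i z.
Proof. by move=> z0; apply: prodr_gt0 => m _; rewrite ltr_pwDl. Qed.

Lemma F_gt0 (R : realType) (q : nat) (z : R) : 0 < z -> 0 < F q z.
Proof. by move=> z0; apply: prodr_gt0 => m _; rewrite ltr_pwDl. Qed.

Lemma rootF_gt0 (R : realType) (q : nat) (z : R) : 0 < z -> 0 < rootF q z.
Proof. by move=> z0; apply/powR_gt0/F_gt0. Qed.

Lemma rootFX (R : realType) (q : nat) (z : R) :
  (0 < q)%N -> 0 < z -> rootF q z ^+ q = F q z.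
Proof.
move=> q_gt0 z0; rewrite -powR_mulrn ?ltW ?rootF_gt0// -powRrM mulVf.
  by rewrite powRr1// ltW// F_gt0.
by rewrite pnatr_eq0 -lt0n.
Qed.

Lemma rho_gt0 (R : realType) (r q : nat) (z : R) : 0 < z -> 0 < rho r q z.
Proof.
move=> z0; rewrite divr_gt0 ?exprn_gt0 ?F_gt0//.
by apply: prodr_gt0 => i _; apply: V_gt0.
Qed.

(** The coefficients of [B], extended to all n; the power of [rootF] absorbs the factor F that V
    gains over each period. *)
Definition normV (R : realType) (r q : nat) (z : R) (n : nat) : R :=
  V r q n z / rootF q z ^+ n.

Lemma normV_periodic (R : realType) (r q j : nat) (z : R) :
  (0 < q)%N -> coprime q r -> 0 < z -> normV r q z (j + q) = normV r q z j.
Proof.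
move=> q_gt0 cop z0; rewrite /normV VDq// exprD rootFX//.
by field; rewrite expf_neq0 !gt_eqF ?rootF_gt0 ?F_gt0.
Qed.

(** * Factorization of P over the Fourier modes *)

Lemma horner_Dpoly (R : realType) (r q : nat) (z : R) :
  (Dpoly R r q).[z] =
  \det (\matrix_(i < q, j < q) \prod_(m < j) (z + (c r q (i + m))%:R)).
Proof.
rewrite -horner_evalE -det_map_mx; congr (\det _).
apply/matrixP => i j; rewrite !mxE rmorph_prod; apply: eq_bigr => m _.
by rewrite /= horner_evalE !hornerE.
Qed.

(* conjugating by diagonal matrices turns the matrix of D into a Hankel matrix
   with q-periodic entries *)
Lemma horner_Dpoly_hankel (R : realType) (r q : nat) (z : R) :
  (0 < q)%N -> 0 < z ->
  (Dpoly R r q).[z] =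
  rho r q z * \det (\matrix_(i < q, j < q) normV r q z (i + j)).
Proof.
move=> q_gt0 z0; rewrite horner_Dpoly; set A := (X in \det X).
have f0 : rootF q z != 0 by rewrite gt_eqF// rootF_gt0.
have V0 i : V r q i z != 0 by rewrite gt_eqF// V_gt0.
pose f := \row_(i < q) rootF q z ^+ i; pose v := \row_(i < q) V r q i z.
(* Both sides have (i, j) entry V_(i+j): [VD] gives the left one, f^i w_(i+j) f^j with w = [normV]
   the right one. *)
have : diag_mx v *m A =
    diag_mx f *m (\matrix_(i < q, j < q) normV r q z (i + j)) *m diag_mx f.
  rewrite mul_mx_diag !mul_diag_mx; apply/matrixP => i j; rewrite !mxE.
  by rewrite /normV exprD VD; field; rewrite !expf_neq0.
move=> /(congr1 determinant); rewrite !det_mulmx !det_diag.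
have -> : \prod_(i < q) v 0 i = \prod_(i < q) V r q i z.
  by apply: eq_bigr => i _; rewrite mxE.
have -> : \prod_(i < q) f 0 i = rootF q z ^+ 'C(q, 2).
  rewrite -bin2_sum big_mkord expr_sum.
  by apply: eq_bigr => i _; rewrite mxE.
(* Since 2 'C(q, 2) = q (q - 1), the powers of [rootF] combine to F^(q-1), the numerator of
   [rho]. *)
rewrite mulrAC -exprD addnn -mul2n -mul_bin_diag bin1 exprM rootFX// => h.
have pV0 : \prod_(i < q) V r q i z != 0 by apply/prodf_neq0 => i _.
by apply: (mulfI pV0); rewrite h /rho; field.
Qed.

(** The sign in P has exponent 'C(q - 1, 2), so it cancels the one from [det_hankel_periodic]. *)
Lemma Ppoly_factorization (R : realType) (r q : nat) (z : R) :
  (0 < q)%N -> coprime q r -> 0 < z ->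
  ((Ppoly R r q).[z])%:C =
  (rho r q z)%:C * \prod_(k < q) B r q z (omega R q ^+ k).
Proof.
move=> q_gt0 cop z0; rewrite /Ppoly hornerM horner_exp hornerN hornerC.
rewrite horner_Dpoly_hankel// !rmorphM rmorphXn rmorphN rmorph1 mulrCA.
congr (_ * _); rewrite -det_map_mx.
case: q => [//|n] in q_gt0 cop *.
rewrite (_ : map_mx _ _ =
    \matrix_(i < n.+1, j < n.+1) (normV r n.+1 z (i + j))%:C); last first.
  by apply/matrixP => i j; rewrite !mxE.
rewrite (det_hankel_periodic (a := fun j => (normV r n.+1 z j)%:C)
  (primitive_omega R q_gt0)); last by move=> j; rewrite normV_periodic.
by rewrite mulrA -exprD bin2 addnn -mul2n mulnC exprM sqrr_sign mul1r.
Qed.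

Lemma conjc_B (R : realType) (r q : nat) (z : R) (xi : R[i]) :
  ((B r q z xi)^*)%C = B r q z (xi^*)%C.
Proof.
rewrite /B rmorph_sum; apply: eq_bigr => i _.
rewrite [LHS](rmorphM (@conjc R)) (rmorphXn (@conjc R)); congr (_ * _).
exact: conjc_real.
Qed.

Lemma B_conj_pair (R : realType) (r q k : nat) (z : R) :
  (0 < q)%N -> (k <= q)%N ->
  B r q z (omega R q ^+ k) * B r q z (omega R q ^+ (q - k)) =
  `|B r q z (omega R q ^+ k)| ^+ 2.
Proof. by move=> q_gt0 le_kq; rewrite sqr_normc conjc_B conjc_omegaX. Qed.

Lemma Ppoly_odd (R : realType) (r q : nat) (z : R) :
  odd q -> coprime q r -> 0 < z ->
  ((Ppoly R r q).[z])%:C = (rho r q z)%:C * B r q z 1 *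
    \prod_(1 <= k < (q.-1)./2.+1) `|B r q z (omega R q ^+ k)| ^+ 2.
Proof.
move=> q_odd cop z0; have q_gt0 := odd_gt0 q_odd.
rewrite Ppoly_factorization// -mulrA; congr (_ * _).
set m := (q.-1)./2; have qE : q = m.*2.+1 by rewrite /m; lia.
rewrite (_ : \prod_(k < q) _ =
  \prod_(k < m.*2.+1) B r q z (omega R q ^+ k)); last by rewrite -qE.
apply: (prod_pair_odd (g := fun k => B r q z (omega R q ^+ k))) => k km.
by rewrite -qE B_conj_pair//; lia.
Qed.

Lemma Ppoly_even (R : realType) (r q : nat) (z : R) :
  (0 < q)%N -> ~~ odd q -> coprime q r -> 0 < z ->
  ((Ppoly R r q).[z])%:C = (rho r q z)%:C * B r q z 1 * B r q z (-1) *
    \prod_(1 <= k < q./2) `|B r q z (omega R q ^+ k)| ^+ 2.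
Proof.
move=> q_gt0 q_even cop z0.
rewrite Ppoly_factorization// -!mulrA; congr (_ * _).
set m := q./2; have qE : q = m.*2 by rewrite /m; lia.
rewrite mulrA (_ : \prod_(k < q) _ =
  \prod_(k < m.*2) B r q z (omega R q ^+ k)); last by rewrite -qE.
have m_gt0 : (0 < m)%N by lia.
(* The self-paired mode k = q/2 is the point -1. *)
have <- : omega R q ^+ m = -1 by rewrite qE omegaX_half.
apply: (prod_pair_even (g := fun k => B r q z (omega R q ^+ k))) => // k km.
by rewrite -qE B_conj_pair//; lia.
Qed.

(** * Sign changes, parity of multiplicities, nonvanishing of D *)

Lemma locally_same_sign (R : realType) (f : R -> R) (x : R) :
  {for x, continuous f} -> f x != 0 ->
  exists2 e : R, 0 < e &
    forall u v : R, x - e < u < x + e -> x - e < v < x + e -> 0 < f u * f v.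
Proof.
move=> cont_f fx0.
have fx2 : 0 < f x * f x by rewrite -expr2 exprn_even_gt0.
have cont_g : {for x, continuous (fun u => f u * f x)}.
  by apply: cvgM; [exact: cont_f|exact: cvg_cst].
have /nbhs_ballP[e /= e0 sub] := cvgr_gt (FF := nbhs_filter x) _ cont_g _ fx2.
exists e => // u v hu hv.
have ball_sgn y : x - e < y < x + e -> 0 < f y * f x.
  by move=> hy; apply: sub; rewrite /ball /= ltr_norml; lra.
(* Uses (f u f v)(f x)^2 = (f u f x)(f v f x). *)
rewrite -(pmulr_lgt0 _ fx2) mulrACA.
by rewrite mulr_gt0 ?ball_sgn.
Qed.

Lemma not_sign_changing (R : realType) (p : {poly R}) (x e : R) :
  0 < e ->
  (forall u v : R, x - e < u < x -> x < v < x + e -> 0 <= p.[u] * p.[v]) ->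
  ~ sign_changing_zero p x.
Proof.
move=> e0 p_ge0 [_ [d d0 p_lt0]].
pose m := Num.min d e; have m0 : 0 < m by rewrite lt_min d0.
have md : m <= d by rewrite ge_min lexx.
have me : m <= e by rewrite ge_min lexx orbT.
have := p_ge0 (x - m / 2) (x + m / 2); have := p_lt0 (x - m / 2) (x + m / 2).
by move=> /(_ ltac:(lra) ltac:(lra)) + /(_ ltac:(lra) ltac:(lra)); lra.
Qed.

(** In p = g (X - x)^m with g(x) nonzero, g keeps its sign near x while the odd power changes
    sign. *)
Lemma odd_mup_sign_changing (R : realType) (p : {poly R}) (x : R) :
  p != 0 -> odd (mup x p) -> sign_changing_zero p x.
Proof.
move=> p0 odd_m; set m := mup x p in odd_m.
have m_gt0 : (0 < m)%N by exact: odd_gt0.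
split; first by rewrite -dvdp_XsubCl XsubC_dvd.
have /dvdpP[g pE] : ('X - x%:P) ^+ m %| p by rewrite -mup_geq.
have g0 : g != 0 by apply: contraNneq p0 => g0; rewrite pE g0 mul0r.
have gx : g.[x] != 0.
  have : mup x p = m by [].
  rewrite {1}pE mupM ?expf_neq0 ?polyXsubC_eq0// mup_XsubCX eqxx => /eqP.
  by rewrite -{2}[m]add0n eqn_add2r -leqn0 leqNgt -XsubC_dvd// dvdp_XsubCl.
have [e e0 g_gt0] := locally_same_sign (@continuous_horner _ g x) gx.
exists e => // u v hu hv; rewrite pE !hornerM !horner_exp !hornerXsubC.
rewrite mulrACA pmulr_rlt0; last by apply: g_gt0; lra.
rewrite -exprMn exprn_odd_lt0//.
have ? : 0 < x - u by lra. have ? : 0 < v - x by lra.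
nra.
Qed.

Lemma even_multiplicity_sign_changing (R : realType) (p : {poly R}) (x : R) :
  p != 0 -> ~ sign_changing_zero p x -> even_multiplicity p x.
Proof. by move=> p0 nsc; split=> //; apply/negP => /(odd_mup_sign_changing p0). Qed.

(* At z = 0 the (i, j) entry contains the factor c_q = 0 as soon as i + j > q
   (or i = 0 < j): listing the rows as 0, q-1, ..., 1 makes the matrix
   triangular. *)
Lemma Dpoly_neq0 (R : realType) (r q : nat) :
  (0 < q)%N -> coprime q r -> Dpoly R r q != 0.
Proof.
move=> q_gt0 cop; suff: (Dpoly R r q).[0] != 0.
  by apply: contraNneq => ->; rewrite horner0.
rewrite horner_Dpoly; case: q => [//|n] in q_gt0 cop *.
set A := (X in \det X).
suff : \det (row_perm (neg_perm n) A) != 0.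
  by rewrite row_permE det_mulmx mulf_eq0 negb_or => /andP[].
have c_eq0 i : (c r n.+1 i == 0)%N = (n.+1 %| i)%N.
  by rewrite /c -/(dvdn _ _) Gauss_dvdl.
rewrite det_trig.
  (* Diagonal entry i is the product of c_(n+1-i+m) over m < i, with all indices strictly between 0
     and n + 1. *)
  apply/prodf_neq0 => i _; rewrite !mxE; apply/prodf_neq0 => m _.
  rewrite add0r pnatr_eq0 c_eq0.
  have lt_mi := ltn_ord m; have i_gt0 : (0 < i)%N by lia.
  rewrite (neg_perm_gt0 i_gt0); have := ltn_ord i => lt_in.
  by rewrite gtnNdvd//; lia.
apply/is_trig_mxP => i j lt_ij; rewrite !mxE.
have ltjn := ltn_ord j.
case: (posnP i) => [i0|i_gt0].
  rewrite (_ : i = ord0); last exact: val_inj.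
  rewrite neg_perm0; have j0 : (0 < j)%N by lia.
  by rewrite (bigD1 (Ordinal j0))//= /c mod0n addr0 mul0r.
rewrite (neg_perm_gt0 i_gt0) (bigD1 (Ordinal lt_ij))//= subnK; last by lia.
by rewrite add0r (_ : c _ _ _ = 0%N) ?mul0r//; apply/eqP; rewrite c_eq0 dvdnn.
Qed.

(** * Signs of P and D on the positive axis *)

(** A real-valued form of B_z(-1), so that continuity and sign arguments can take place in [R]. *)
Definition Bm (R : realType) (r q : nat) (z : R) : R :=
  \sum_(i < q) (-1) ^+ i * normV r q z i.

Lemma B_N1 (R : realType) (r q : nat) (z : R) :
  B r q z (-1) = (Bm r q z)%:C.
Proof.
rewrite /Bm rmorph_sum; apply: eq_bigr => i _.
by rewrite [RHS]rmorphM [in RHS]rmorphXn rmorphN1 mulrC.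
Qed.

Lemma B_1_ge0 (R : realType) (r q : nat) (z : R) : 0 < z -> 0 <= B r q z 1.
Proof.
move=> z0; apply: sumr_ge0 => i _; rewrite expr1n mulr1 ler0c.
by rewrite divr_ge0 ?exprn_ge0 ?ltW ?V_gt0 ?rootF_gt0.
Qed.

Lemma Ppoly_odd_ge0 (R : realType) (r q : nat) (z : R) :
  odd q -> coprime q r -> 0 < z -> 0 <= (Ppoly R r q).[z].
Proof.
move=> q_odd cop z0; rewrite -ler0c Ppoly_odd//.
rewrite !mulr_ge0 ?B_1_ge0 ?ler0c ?(ltW (rho_gt0 r q z0))//.
by apply: prodr_ge0 => k _; rewrite exprn_ge0.
Qed.

(** The sign relating P to D squares to 1, so sign changes of D can be read off from P. *)
Lemma Dpoly_mul (R : realType) (r q : nat) (u v : R) :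
  (Dpoly R r q).[u] * (Dpoly R r q).[v] = (Ppoly R r q).[u] * (Ppoly R r q).[v].
Proof.
rewrite /Ppoly !hornerM !horner_exp !hornerN !hornerC mulrACA -expr2.
by rewrite sqrr_sign mul1r.
Qed.

Lemma continuous_Bm (R : realType) (r q : nat) (x : R) :
  0 < x -> {for x, continuous (fun z : R => Bm r q z)}.
Proof.
move=> x0; apply: cvg_big => [|i _]; first exact: add_continuous.
have cont_prod (n : nat) (a : 'I_n -> nat) :
    continuous (fun z : R => \prod_(m < n) (z + (a m)%:R)).
  apply: continuous_big => [|m _]; first exact: mul_continuous.
  by move=> y; apply: cvgD; [exact: cvg_id|exact: cvg_cst].
apply: cvgM; first exact: cvg_cst.
apply: cvgM; first exact: cont_prod.
apply: cvgV; first by rewrite expf_neq0// gt_eqF// rootF_gt0.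
apply: (continuous_comp (f := rootF q) (g := fun y => y ^+ i)); last first.
  exact: exprn_continuous.
apply: (continuous_comp (f := F q) (g := fun y => y `^ q%:R^-1)).
  exact: cont_prod.
(* The real power is differentiable at positive arguments, and F(x) > 0. *)
apply/differentiable_continuous/derivable1_diffP/derivable_powR.
by rewrite in_itv/= andbT F_gt0.
Qed.

(** All factors of P other than the one at -1 are nonnegative. *)
Lemma Dpoly_even_ge0 (R : realType) (r q : nat) (u v : R) :
  (0 < q)%N -> ~~ odd q -> coprime q r -> 0 < u -> 0 < v ->
  0 <= Bm r q u * Bm r q v -> 0 <= (Dpoly R r q).[u] * (Dpoly R r q).[v].
Proof.
move=> q_gt0 q_even cop u0 v0 B_ge0.
rewrite Dpoly_mul -ler0c (rmorphM (real_complex R)) /= !Ppoly_even// !B_N1.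
rewrite mulrACA [X in X * _]mulrACA -(rmorphM (real_complex R)).
rewrite !mulr_ge0 ?B_1_ge0 ?ler0c ?(ltW (rho_gt0 r q u0))
  ?(ltW (rho_gt0 r q v0))// prodr_ge0// => k _; exact: exprn_ge0.
Qed.

Lemma sign_changing_even (R : realType) (r q : nat) (x : R) :
  (0 < q)%N -> ~~ odd q -> coprime q r -> 0 < x ->
  sign_changing_zero (Dpoly R r q) x -> B r q x (-1) = 0.
Proof.
move=> q_gt0 q_even cop x0 sc; apply/eqP/negPn/negP; rewrite B_N1 fmorph_eq0.
move=> /(locally_same_sign (@continuous_Bm R r q x x0))[e e0 B_gt0].
(* The bound by x keeps u and v positive. *)
pose m := Num.min e x; have m0 : 0 < m by rewrite lt_min e0.
have me : m <= e by rewrite ge_min lexx.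
have mx : m <= x by rewrite ge_min lexx orbT.
move: sc; apply: (not_sign_changing m0) => u v hu hv.
by apply: Dpoly_even_ge0 => //; [lra|lra|apply/ltW/B_gt0; lra].
Qed.

Theorem corollary4 (R : realType) (q r : nat)
    (hq : (2 <= q)%N) (hr : (1 <= r < q)%N) (hcop : coprime q r) :
  (odd q ->
    (forall z : R, 0 < z ->
       ((Ppoly R r q).[z])%:C =
         (rho r q z)%:C * B r q z 1 *
         \prod_(1 <= k < (q.-1)./2.+1) `|B r q z (omega R q ^+ k)| ^+ 2
       /\ 0 <= (Ppoly R r q).[z])
    /\
    (forall z0 : R, 0 < z0 -> root (Dpoly R r q) z0 ->
       even_multiplicity (Dpoly R r q) z0
       /\ ~ sign_changing_zero (Dpoly R r q) z0))
  /\
  (~~ odd q ->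
    (forall z : R, 0 < z ->
       ((Ppoly R r q).[z])%:C =
         (rho r q z)%:C * B r q z 1 * B r q z (-1) *
         \prod_(1 <= k < q./2) `|B r q z (omega R q ^+ k)| ^+ 2
       /\ B r q z (-1) =
         (\sum_(i < q) (-1) ^+ i * (V r q i z / rootF q z ^+ i))%:C)
    /\
    (forall z0 : R, 0 < z0 -> sign_changing_zero (Dpoly R r q) z0 ->
       B r q z0 (-1) = 0)
    /\
    (forall z0 : R, 0 < z0 -> root (Dpoly R r q) z0 -> B r q z0 (-1) != 0 ->
       even_multiplicity (Dpoly R r q) z0)).
Proof.
have q_gt0 : (0 < q)%N := ltnW hq.
have D0 : Dpoly R r q != 0 := Dpoly_neq0 R q_gt0 hcop.
split=> q_odd; split.
- by move=> z z0; split; [exact: Ppoly_odd|exact: Ppoly_odd_ge0].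
- move=> x x0 _.
  have nsc : ~ sign_changing_zero (Dpoly R r q) x.
    (* Radius x keeps u and v in the positive range, where P is nonnegative. *)
    apply: (not_sign_changing x0) => u v hu hv; rewrite Dpoly_mul.
    by rewrite mulr_ge0// Ppoly_odd_ge0//; lra.
  by split=> //; exact: even_multiplicity_sign_changing.
- by move=> z z0; split; [exact: Ppoly_even|exact: B_N1].
- split=> x x0; first exact: sign_changing_even.
  move=> _ /eqP B0; apply: even_multiplicity_sign_changing => // sc.
  exact/B0/sign_changing_even.
Qed.
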